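(* Let $1\le \ell\le m$ be integers. The function $E_\ell$ is geodesically log-convex on the set of $m\times m$ (symmetric) positive definite matrices; that is, for all $m\times m$ positive definite matrices $P,Q$ and all $t\in[0,1]$, $$\log E_\ell(P\#_t Q)\le (1-t)\log E_\ell(P)+t\log E_\ell(Q).$$
   Context: For a symmetric $m\times m$ matrix $M$ with eigenvalues $\lambda_1,\dots,\lambda_m$, $E_\ell(M)=\sum_{I\subseteq\{1,\dots,m\},\,|I|=\ell}\prod_{j\in I}\lambda_j$. For positive definite $P,Q$ and $t\in[0,1]$, $P\#_tQ:=P^{1/2}(P^{-1/2}QP^{-1/2})^tP^{1/2}$ is the geodesic between $P$ and $Q$ for the Riemannian metric $g_P(X,Y)=\mathrm{tr}(P^{-1}XP^{-1}Y)$. A function $f$ on positive definite matrices is geodesically convex if $f(P\#_tQ)\le(1-t)f(P)+tf(Q)$ for all $t\in[0,1]$ and all positive definite $P,Q$; it is geodesically log-convex if it is positive and $\log f$ is geodesically convex. *)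

(* Defs.v *)
From HB Require Import structures.
From mathcomp Require Import all_boot all_order all_algebra all_fingroup.
From mathcomp Require Import boolp classical_sets reals exp.

Set Implicit Arguments.
Unset Strict Implicit.
Unset Printing Implicit Defensive.

Import Order.TTheory GRing.Theory Num.Theory.
Local Open Scope ring_scope.

Section Definitions.
Variables (R : realType) (m : nat).
Implicit Types (A B P Q U V M : 'M[R]_m) (d : 'rV[R]_m) (t : R).

Definition posdefmx P : Prop :=
  P \is symmetricmx /\
  forall x : 'cV[R]_m, x != 0 -> 0 < (x^T *m P *m x) 0 0.

(* A = U diag(d) U^T with U orthogonal *)
Definition spectral_decomposition A U d : Prop :=
  U *m U^T = 1%:M /\ A = U *m diag_mx d *m U^T.

(* The real power A^t of a positive definite A: if A = U diag(d) U^T with U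
   orthogonal, then A^t = U diag(d_1^t, ..., d_m^t) U^T; the value does
   not depend on the decomposition (mxpowRE).  If A has no such decomposition, i.e.
   is not symmetric, the value is the dummy 0. *)
Definition mxpowR A t : 'M[R]_m :=
  xget 0 [set B | exists U d, spectral_decomposition A U d /\
                    B = U *m diag_mx (map_mx (fun a => a `^ t) d) *m U^T]%classic.

Definition geomean t P Q : 'M[R]_m :=
  mxpowR P (1 / 2) *m
  mxpowR (mxpowR P (- (1 / 2)) *m Q *m mxpowR P (- (1 / 2))) t *m
  mxpowR P (1 / 2).

(* lambda lists the eigenvalues of M with their algebraic multiplicities *)
Definition eigenvalue_list M (lambda : m.-tuple R) : Prop :=
  char_poly M = \prod_(a <- lambda) ('X - a%:P).

(* Some such list, unique up to permutation, so that Esym does not depend on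
   the choice (EsymE); the dummy list of zeros if the eigenvalues of M are not all
   in R, which does not happen for symmetric M. *)
Definition eigenvalues M : m.-tuple R :=
  xget [tuple 0 | i < m] [set lambda | eigenvalue_list M lambda]%classic.

Definition elem_sym (l : nat) (lambda : m.-tuple R) : R :=
  \sum_(I : {set 'I_m} | #|I| == l) \prod_(j in I) tnth lambda j.

Definition Esym (l : nat) M : R := elem_sym l (eigenvalues M).

Definition geodesically_convex (f : 'M[R]_m -> R) : Prop :=
  forall P Q t, posdefmx P -> posdefmx Q -> 0 <= t <= 1 ->
    f (geomean t P Q) <= (1 - t) * f P + t * f Q.

Definition geodesically_log_convex (f : 'M[R]_m -> R) : Prop :=
  (forall P, posdefmx P -> 0 < f P) /\
  geodesically_convex (fun P => ln (f P)).

Lemma mxpowRE A t U d : spectral_decomposition A U d ->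
  mxpowR A t = U *m diag_mx (map_mx (fun a => a `^ t) d) *m U^T.
Proof.
move=> AUd; rewrite /mxpowR.
case: xgetP => [B _ [V [e [AVe ->]]]|/(_ (U *m diag_mx (map_mx (fun a => a `^ t) d) *m U^T)) []];
  last by exists U, d.
have [[UU AU] [VV AV]] := (AUd, AVe).
have U'U : U^T *m U = 1%:M by apply: mulmx1C.
have V'V : V^T *m V = 1%:M by apply: mulmx1C.
have WE : (V^T *m U) *m diag_mx d = diag_mx e *m (V^T *m U).
  have : V^T *m A *m U = V^T *m A *m U by [].
  rewrite {1}AU AV !mulmxA V'V mul1mx -!mulmxA U'U mulmx1.
  by rewrite !mulmxA.
have WF : (V^T *m U) *m diag_mx (map_mx (fun a => a `^ t) d) =
          diag_mx (map_mx (fun a => a `^ t) e) *m (V^T *m U).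
  apply/matrixP => i j; move/matrixP/(_ i j): WE.
  rewrite !mul_mx_diag !mul_diag_mx !mxE.
  set w := (\sum_j _); rewrite mulrC => /eqP; rewrite -subr_eq0 -mulrBl mulf_eq0.
  rewrite subr_eq0 => /orP[/eqP -> | /eqP ->]; first by rewrite mulrC.
  by rewrite mul0r mulr0.
have := congr1 (fun X => V *m X *m U^T) WF.
by rewrite /= !mulmxA VV mul1mx => ->; rewrite -!mulmxA UU mulmx1 !mulmxA.
Qed.

Lemma EsymE l M (lambda : m.-tuple R) :
  eigenvalue_list M lambda -> Esym l M = elem_sym l lambda.
Proof.
move=> Ml; rewrite /Esym /eigenvalues.
case: xgetP => [mu _ Mmu|/(_ lambda)]; last by case.
have : perm_eq mu lambda.
  by apply: prod_XsubC_eq; rewrite -Ml -Mmu.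
case/tuple_permP => s mus.
have muE i : tnth mu i = tnth lambda (s i).
  by rewrite (tnth_nth 0) mus -tnth_nth tnth_mktuple.
rewrite /elem_sym [RHS](reindex_inj (imset_inj (@perm_inj _ s))).
apply: eq_big => [I|I _]; first by rewrite card_imset //; exact: perm_inj.
rewrite [RHS]big_imset /=; last by move=> x y _ _; exact: perm_inj.
by apply: eq_bigr => i _.
Qed.

End Definitions.

(* Main.v *)
(** Simultaneous diagonalization writes [P = X X^T], [Q = X diag(d) X^T] and
    [P #_t Q = X diag(d^t) X^T] with [X] invertible and [d > 0].  Since
    [X diag(d) X^T] is similar to [diag(d) X^T X], and [E_l] is the sum of the
    principal minors of size [l],
      [E_l (P #_t Q) = \sum_(|I| = l) c_I (\prod_(i in I) d_i)^t],
    where the [c_I] are the principal minors of the positive definite matrix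
    [X^T X].  Such a sum of exponentials with positive coefficients is
    log-convex in [t]. *)

Require Import Defs.
From mathcomp Require Import all_boot all_order all_algebra reals.
From mathcomp Require Import all_fingroup boolp sequences exp complex ring lra.

Set Implicit Arguments.
Unset Strict Implicit.
Unset Printing Implicit Defensive.
Import Order.TTheory GRing.Theory Num.Theory.
Local Open Scope ring_scope.

(** * Principal minors as coefficients of the characteristic polynomial *)

Lemma det_add (K : comNzRingType) m (A B : 'M[K]_m) :
  \det (A + B) =
  \sum_(I : {set 'I_m}) \det (\matrix_(i, j) if i \in I then A i j else B i j).
Proof.
rewrite /determinant exchange_big; apply: eq_bigr => s _ /=.
under eq_bigr do rewrite mxE.
(* In each Leibniz term the product of two-term sums is expanded; [I] is the set of rows in which
   the entry of [A] is chosen. *)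
rewrite bigA_distr big_distrr; apply: eq_bigr => I _ /=; congr (_ * _).
by apply: eq_bigr => i _; rewrite mxE.
Qed.

Section PrincipalMinors.
Variables (K : comNzRingType) (m : nat).
Implicit Types (A B : 'M[K]_m) (I : {set 'I_m}).

(* Its determinant is the principal minor of A with index set I. *)
Definition row_mask I A : 'M[K]_m :=
  \matrix_(i, j) if i \in I then A i j else (i == j)%:R.

(** A left diagonal factor scales rows, and the masked rows stay rows of the identity, so only the
    scalars indexed by [I] come out. This later separates the exponentials from the constants in
    [Esym]. *)
Lemma det_row_mask_mul I A (d : 'rV[K]_m) :
  \det (row_mask I (diag_mx d *m A)) = (\prod_(i in I) d 0 i) * \det (row_mask I A).
Proof.
pose e : 'rV[K]_m := \row_i if i \in I then d 0 i else 1.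
have -> : row_mask I (diag_mx d *m A) = diag_mx e *m row_mask I A.
  apply/matrixP => i j; rewrite !mul_diag_mx !mxE.
  by case: ifP => // _; rewrite mul1r.
rewrite det_mulmx det_diag; congr (_ * _); rewrite [RHS]big_mkcond.
by apply: eq_bigr => i _; rewrite mxE.
Qed.

Lemma row_mask1 I : row_mask I 1%:M = 1%:M.
Proof. by apply/matrixP => i j; rewrite !mxE if_same. Qed.

(* A permutation contributing to the left-hand side fixes the complement of I,
   hence preserves I. *)
Lemma det_row_mask_sym I A :
  \det (row_mask I A) =
  \det (\matrix_(i, j) if (i \in I) && (j \in I) then A i j else (i == j)%:R).
Proof.
apply: eq_bigr => s _; congr (_ * _).
have [i /andP[iI sii]|sI] := pickP [pred i | (i \notin I) && (s i != i)].
  by rewrite (bigD1 i) //= [RHS](bigD1 i) //= !mxE (negbTE iI) eq_sym (negbTE sii) !mul0r.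
apply: eq_bigr => i _; rewrite !mxE; case: ifP => //= iI.
case: ifP => // siI; have := sI (s i); rewrite /= siI /= => /negbFE /eqP /perm_inj sii.
by rewrite sii iI in siI.
Qed.

(** Row-wise expansion of the determinant of -A + X·1: rows in [I] come from -A and the others from
    X·1. Pulling -1 or X out of each row leaves the masked matrix. *)
Lemma char_poly_row_mask A :
  char_poly A = \sum_(I : {set 'I_m}) ((-1) ^+ #|I| * \det (row_mask I A)) *: 'X^(m - #|I|).
Proof.
rewrite /char_poly /char_poly_mx addrC det_add; apply: eq_bigr => I _.
pose e : 'rV[{poly K}]_m := \row_i if i \in I then -1 else 'X.
transitivity (\det (diag_mx e *m map_mx (@polyC K) (row_mask I A))).
  congr (\det _); apply/matrixP => i j; rewrite mul_diag_mx !mxE.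
  by case: ifP => _; rewrite ?mulN1r // polyC_natr mulr_natr.
rewrite det_mulmx det_diag det_map_mx.
have -> : \prod_i e 0 i = (-1) ^+ #|I| * 'X^(m - #|I|).
  under eq_bigr do rewrite mxE.
  rewrite (bigID (mem I)) /=; congr (_ * _).
    by rewrite (eq_bigr (fun=> -1)) => [|i ->//]; rewrite prodr_const.
  rewrite (eq_bigr (fun=> 'X)) => [|i /negbTE->//].
  rewrite (eq_bigl (mem (~: I))) => [|i]; last by rewrite /= inE.
  rewrite prodr_const; congr (_ ^+ _).
  by rewrite -[X in (X - _)%N]card_ord -(cardsC I) addKn.
by rewrite -mul_polyC polyCM polyC_exp polyCN polyC1 mulrAC.
Qed.

Lemma coef_char_poly A l : (l <= m)%N ->
  (char_poly A)`_(m - l) =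
  (-1) ^+ l * \sum_(I : {set 'I_m} | #|I| == l) \det (row_mask I A).
Proof.
move=> lm; rewrite char_poly_row_mask coef_sum big_distrr [RHS]big_mkcond /=.
apply: eq_bigr => I _; rewrite coefZ coefXn.
have Im : (#|I| <= m)%N by rewrite -[X in (_ <= X)%N]card_ord max_card.
have -> : (m - l == m - #|I|)%N = (#|I| == l).
  by apply/eqP/eqP => [|->//]; move/(congr1 (subn m)); rewrite !subKn.
by case: eqP => [->|_]; rewrite ?mulr1 ?mulr0.
Qed.

End PrincipalMinors.

Lemma char_poly_similar (K : comUnitRingType) m (X A : 'M[K]_m) : X \in unitmx ->
  char_poly (X *m A *m invmx X) = char_poly A.
Proof.
move=> uX; rewrite /char_poly /char_poly_mx.
pose Y := map_mx (@polyC K) X; pose Z := map_mx (@polyC K) (invmx X).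
have YZ : Y *m Z = 1%:M by rewrite -map_mxM mulmxV // map_mx1.
have -> : 'X%:M - map_mx polyC (X *m A *m invmx X) =
    Y *m ('X%:M - map_mx polyC A) *m Z.
  rewrite mulmxBr mulmxBl !map_mxM; congr (_ - _).
  by rewrite scalar_mxC -mulmxA YZ mulmx1.
by rewrite !det_mulmx mulrAC -det_mulmx YZ det1 mul1r.
Qed.

(** Both sides depend on [M] only through its characteristic polynomial, so [M] may be replaced by
    the diagonal matrix of [lambda], whose principal minors are the products of the selected
    eigenvalues. *)
Lemma elem_sym_char_poly (R : realType) m (M : 'M[R]_m) l (lambda : m.-tuple R) :
  (l <= m)%N -> eigenvalue_list M lambda ->
  elem_sym l lambda = (-1) ^+ l * (char_poly M)`_(m - l).
Proof.
move=> lm ML; pose d : 'rV[R]_m := \row_i tnth lambda i.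
have -> : char_poly M = char_poly (diag_mx d).
  rewrite ML char_poly_trig ?diag_mx_is_trig // big_tuple.
  by apply: eq_bigr => i _; rewrite !mxE eqxx mulr1n.
rewrite coef_char_poly // mulrA -exprMn mulrNN mulr1 expr1n mul1r.
apply: eq_bigr => I _; rewrite -[diag_mx d]mulmx1 det_row_mask_mul row_mask1 det1 mulr1.
by apply: eq_bigr => i _; rewrite mxE.
Qed.

(** * The spectral theorem for real symmetric matrices *)

Lemma symmetricmxP (K : fieldType) n (S : 'M[K]_n) :
  reflect (S^T = S) (S \is symmetricmx).
Proof.
by apply: (iffP (is_hermitianmxP _ _ _)); rewrite expr0 scale1r map_mx_id // => {2}->.
Qed.

Section RealSpectral.
Variable R : realType.

(** Seen over the complex numbers, [S] is Hermitian, hence unitarily diagonalizable with real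
    diagonal. Any diagonal entry is then a real root, and it descends along the injective embedding
    of [R]. *)
Lemma symmetric_eigenvalue n (S : 'M[R]_n.+1) : S \is symmetricmx ->
  exists a, root (char_poly S) a.
Proof.
move=> Ssym; pose T := map_mx (real_complex R) S.
have Tsym : T \is symmetricmx.
  by apply/symmetricmxP; rewrite map_trmx; congr map_mx; apply/symmetricmxP.
have Treal : T \is a mxOver Num.real.
  by apply/mxOverP => i j; rewrite mxE complex_real.
have Therm := realsym_hermsym Tsym Treal.
have /orthomx_spectralP TE := hermitian_normalmx Therm.
have dreal := hermitian_spectral_diag_real Therm.
have rT : root (char_poly T) (spectral_diag T 0 0).
  rewrite [X in char_poly X]TE -[X in _ *m X]invmxK.
  rewrite char_poly_similar ?unitmx_inv ?spectral_unit //.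
  rewrite char_poly_trig ?diag_mx_is_trig // (bigD1 0) //= rootM root_XsubC.
  by rewrite [diag_mx _ _ _]mxE eqxx mulr1n eqxx.
have /RRe_real dE : spectral_diag T 0 0 \is Num.real by apply: (mxOverP dreal).
exists (complex.Re (spectral_diag T 0 0)).
by move: rT; rewrite -map_char_poly -[X in root _ X]dE fmorph_root.
Qed.

Lemma sqnorm_gt0 n (x : 'cV[R]_n) : x != 0 -> 0 < (x^T *m x) 0 0.
Proof.
move=> x0; have x2 (i : 'I_n) : 0 <= x^T 0 i * x i 0 by rewrite mxE -expr2 sqr_ge0.
rewrite lt0r mxE sumr_ge0 // andbT; apply: contraNneq x0 => /psumr_eq0P xi0.
apply/eqP/colP => i; rewrite mxE; apply/eqP.
by rewrite -sqrf_eq0 expr2 -[X in X * _](mxE trmx_key (fun j i => x i j)) xi0.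
Qed.

(* The Householder reflection exchanging the first basis vector and the unit vector v. *)
Lemma orthogonal_first_row n (v : 'rV[R]_n.+1) : v *m v^T = 1%:M ->
  exists2 H : 'M[R]_n.+1, H *m H^T = 1%:M & row 0 H = v.
Proof.
move=> vv; pose e : 'rV[R]_n.+1 := delta_mx 0 0; pose w := v - e.
have [/eqP|w0] := eqVneq w 0.
  rewrite subr_eq0 => /eqP ve; exists 1%:M; first by rewrite trmx1 mulmx1.
  by rewrite ve row1.
(* Since [v] and [e] are unit vectors, [w] has squared norm 2(1 - v_0), so [c] is the usual
   Householder factor 2/|w|^2. It makes sense because the case w = 0 is settled above by the
   identity. *)
pose c := (1 - v 0 0)^-1.
have ve : v *m e^T = (v 0 0)%:M.
  by rewrite trmx_delta -colE [LHS]mx11_scalar mxE.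
have ev : e *m v^T = (v 0 0)%:M by rewrite -[e]trmxK -trmx_mul ve tr_scalar_mx.
have ee : e *m e^T = 1%:M.
  by rewrite trmx_delta mul_delta_mx [LHS]mx11_scalar mxE !eqxx.
have ww : w *m w^T = (2 * (1 - v 0 0))%:M.
  rewrite /w linearB /= mulmxBl !mulmxBr vv ve ev ee [LHS]mx11_scalar !mxE eqxx.
  by rewrite !mulr1n; congr _%:M; ring.
have v1 : 1 - v 0 0 != 0.
  have := @sqnorm_gt0 _ w^T; rewrite trmxK ww mxE eqxx mulr1n.
  rewrite -trmx0 (inj_eq trmx_inj) => /(_ w0); apply: contraTneq => ->.
  by rewrite mulr0 ltxx.
pose H := 1%:M - c *: (w^T *m w).
have HT : H^T = H by rewrite /H linearB /= trmx1 linearZ /= trmx_mul trmxK.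
exists H.
  rewrite HT; pose G := w^T *m w.
  have GG : G *m G = (2 * (1 - v 0 0)) *: G.
    by rewrite /G -mulmxA (mulmxA w) ww mul_scalar_mx -scalemxAr.
  rewrite /H -/G mulmxBl mul1mx mulmxBr mulmx1 -scalemxAl -scalemxAr GG !scalerA.
  have -> : c * c * (2 * (1 - v 0 0)) = c + c by rewrite /c; field.
  by rewrite scalerDl opprB addrK subrK.
rewrite rowE -/e /H mulmxBr mulmx1 -scalemxAr mulmxA.
have -> : e *m w^T = (- (1 - v 0 0))%:M.
  by rewrite /w linearB /= mulmxBr ev ee -raddfB opprB.
by rewrite mul_scalar_mx scalerA mulrN mulVf // scaleN1r opprK /w addrC subrK.
Qed.

(** Induction on the size: an orthogonal matrix with a unit eigenvector as its first row conjugates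
    [S] to a block matrix diag(a, T'), and the induction hypothesis diagonalizes the symmetric block
    T'. *)
Lemma symmetric_spectral n (S : 'M[R]_n) : S \is symmetricmx ->
  exists U d, spectral_decomposition S U d.
Proof.
elim: n S => [|n IHn] S Ssym.
  by exists 1%:M, 0; split; [rewrite trmx1 mulmx1|rewrite [LHS]flatmx0 [RHS]flatmx0].
have ST : S^T = S by apply/symmetricmxP.
have [a] := symmetric_eigenvalue Ssym; rewrite -eigenvalue_root_char.
case/eigenvalueP => v vS v0.
pose q := (v *m v^T) 0 0; pose r := (Num.sqrt q)^-1; pose u := r *: v.
have q0 : 0 < q.
  by rewrite /q -[X in X *m _]trmxK sqnorm_gt0 // -trmx0 (inj_eq trmx_inj).
have [H HH H0] : exists2 H : 'M[R]_n.+1, H *m H^T = 1%:M & row 0 H = u.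
  apply: orthogonal_first_row.
  have vvE : v *m v^T = q%:M by rewrite [LHS]mx11_scalar.
  have r2 : r * r * q = 1.
    by rewrite /r -invfM -expr2 sqr_sqrtr ?ltW // mulVf // gt_eqF.
  clearbody r q; rewrite /u linearZ /= -scalemxAl -scalemxAr scalerA vvE.
  by rewrite scale_scalar_mx r2.
have H'H : H^T *m H = 1%:M by apply: mulmx1C.
pose T : 'M[R]_(1 + n) := H *m S *m H^T.
have TT : T^T = T by rewrite /T !trmx_mul trmxK ST mulmxA.
(* Row 0 of [H] is the eigenvector [u], so this row is a·u H^T, and u H^T is row 0 of H H^T = 1.
   Symmetry of [T] then clears the first column as well. *)
have T0 : row 0 T = a *: row 0 1%:M.
  rewrite /T !row_mul H0 /u -scalemxAl vS scalerA mulrC -scalerA -/u -H0.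
  by rewrite -scalemxAl -row_mul HH.
have SE : S = H^T *m T *m H by rewrite /T !mulmxA H'H mul1mx -mulmxA H'H mulmx1.
clearbody T; pose T' := drsubmx T.
have TE : T = block_mx a%:M 0 0 T'.
  have ur : ursubmx T = 0.
    apply/rowP => j; have /rowP/(_ (rshift 1 j)) := T0.
    rewrite !mxE /= mulr0 => <-; congr (T _ _); exact: val_inj.
  rewrite -[LHS]submxK ur -[dlsubmx T]trmxK trmx_dlsub TT ur trmx0; congr block_mx.
  rewrite [LHS]mx11_scalar; congr _%:M.
  by have /rowP/(_ 0) := T0; rewrite !mxE eqxx mulr1 => <-; congr (T _ _); exact: val_inj.
have [U [d [UU UE]]] : exists U d, spectral_decomposition T' U d.
  by apply: IHn; apply/symmetricmxP; rewrite /T' trmx_drsub TT.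
pose B : 'M[R]_(1 + n) := block_mx 1%:M 0 0 U; pose d' : 'rV[R]_(1 + n) := row_mx a%:M d.
have BB : B *m B^T = 1%:M.
  rewrite tr_block_mx mulmx_block !trmx1 !trmx0.
  by rewrite !(mulmx0, mul0mx, mulmx1, addr0, add0r) UU -scalar_mx_block.
have TB : T = B *m diag_mx d' *m B^T.
  rewrite TE tr_block_mx diag_mx_row !mulmx_block !trmx1 !trmx0.
  rewrite !(mulmx0, mul0mx, mulmx1, mul1mx, addr0, add0r) -UE; congr block_mx.
  by rewrite [RHS]mx11_scalar !mxE eqxx !mulr1n.
clearbody B d'; exists (H^T *m B), d'; split.
  by rewrite trmx_mul trmxK mulmxA -(mulmxA _ B) BB mulmx1.
by rewrite SE TB trmx_mul trmxK !mulmxA.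
Qed.

End RealSpectral.

(** * Positive definite matrices, their principal minors, and simultaneous diagonalization *)

Section PositiveDefinite.
Variables (R : realType) (m : nat).
Implicit Types (P Q S X U : 'M[R]_m) (d : 'rV[R]_m) (I : {set 'I_m}).

Definition powR_row t d : 'rV[R]_m := map_mx (fun a => a `^ t) d.

Lemma posdefmx_congr X S : X \in unitmx -> posdefmx S -> posdefmx (X *m S *m X^T).
Proof.
move=> uX [/symmetricmxP ST Spos]; split.
  by apply/symmetricmxP; rewrite !trmx_mul trmxK ST mulmxA.
move=> x x0; have := Spos (X^T *m x); rewrite trmx_mul trmxK !mulmxA; apply.
apply: contraNneq x0 => Xx; have : invmx X^T *m (X^T *m x) = x by rewrite mulKmx ?unitmx_tr.
by rewrite Xx mulmx0 => <-.
Qed.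

Lemma posdefmx_diag_gt0 S i : posdefmx S -> 0 < S i i.
Proof.
move=> [_ /(_ (delta_mx i 0))]; rewrite trmx_delta -rowE -colE !mxE; apply.
by apply/eqP => /matrixP/(_ i 0)/eqP; rewrite !mxE !eqxx oner_eq0.
Qed.

Lemma orthogonal_unitmx U : U *m U^T = 1%:M -> U \in unitmx.
Proof. by case/mulmx1_unit. Qed.

(** The congruent matrix U^T P U = diag(d) is again positive definite, so its diagonal is
    positive. *)
Lemma posdefmx_spectral_gt0 P U d i :
  posdefmx P -> spectral_decomposition P U d -> 0 < d 0 i.
Proof.
move=> Ppos [UU PE]; have U'U : U^T *m U = 1%:M by apply: mulmx1C.
have /posdefmx_diag_gt0 : posdefmx (U^T *m P *m U^T^T).
  by apply: posdefmx_congr => //; rewrite unitmx_tr orthogonal_unitmx.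
move=> /(_ i); rewrite PE trmxK !mulmxA U'U mul1mx -mulmxA U'U mulmx1.
by rewrite mxE eqxx mulr1n.
Qed.

Lemma posdefmx_det_gt0 S : posdefmx S -> 0 < \det S.
Proof.
move=> Spos; have [U [d SUd]] := symmetric_spectral Spos.1.
have [UU ->] := SUd; rewrite !det_mulmx mulrAC -det_mulmx UU det1 mul1r det_diag.
by apply: prodr_gt0 => i _; exact: posdefmx_spectral_gt0 SUd.
Qed.

(** The row mask need not be symmetric, so it is first replaced by the two-sided mask of equal
    determinant. With [J] the coordinate projection onto [I] and N = 1 - J, that matrix is J S J + N
    N. Its quadratic form at x is the form of [S] at Jx plus |Nx|^2, and Jx, Nx cannot both vanish
    when x is nonzero. *)
Lemma det_row_mask_gt0 S I : posdefmx S -> 0 < \det (row_mask I S).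
Proof.
move=> [/symmetricmxP ST Spos]; rewrite det_row_mask_sym; apply: posdefmx_det_gt0.
pose J : 'M[R]_m := diag_mx (\row_i (i \in I)%:R); pose N : 'M[R]_m := 1%:M - J.
have JT : J^T = J by rewrite tr_diag_mx.
have NT : N^T = N by rewrite /N linearB /= trmx1 JT.
set M := (X in posdefmx X).
have ME : M = J *m S *m J + N *m N.
  have -> : N *m N = diag_mx (\row_i (i \notin I)%:R).
    have -> : N = diag_mx (\row_i (i \notin I)%:R).
      apply/matrixP => i j; rewrite !mxE; case: eqP => [->|]; rewrite ?subr0 //.
      by case: (j \in I); rewrite ?subrr ?subr0.
    apply/matrixP => i j; rewrite mul_diag_mx !mxE.
    by case: (i \in I) => /=; rewrite ?mul0r ?mul0rn ?mul1r.
  apply/matrixP => i j; rewrite [RHS]mxE /J mul_mx_diag [X in X + _]mxE mul_diag_mx !mxE.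
  have [->|ij] := eqVneq i j; last first.
    by case: (i \in I); case: (j \in I); rewrite /= ?(mulr0, mul0r, mulr1, mul1r, addr0).
  by case: (j \in I); rewrite /= ?(mulr0, mul0r, mulr1, mul1r, addr0, add0r).
have S0 (x : 'cV[R]_m) : 0 <= (x^T *m S *m x) 0 0.
  have [->|x0] := eqVneq x 0; [by rewrite mulmx0 mxE|exact/ltW/Spos].
have q0 n (x : 'cV[R]_n) : 0 <= (x^T *m x) 0 0.
  have [->|x0] := eqVneq x 0; [by rewrite mulmx0 mxE|exact/ltW/sqnorm_gt0].
split=> [|x x0].
  by apply/symmetricmxP; rewrite ME linearD /= !trmx_mul ST JT NT mulmxA.
have -> : (x^T *m M *m x) 0 0 =
    ((J *m x)^T *m S *m (J *m x)) 0 0 + ((N *m x)^T *m (N *m x)) 0 0.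
  by rewrite ME mulmxDr mulmxDl mxE !trmx_mul JT NT !mulmxA.
have xE : J *m x + N *m x = x by rewrite -mulmxDl /N addrC subrK mul1mx.
have [Nx|Nx] := eqVneq (N *m x) 0.
  rewrite Nx mulmx0 [X in _ + X]mxE addr0; apply: Spos; apply: contraNneq x0 => Jx.
  by rewrite -xE Jx Nx addr0.
by apply: ltr_wpDl => //; exact: sqnorm_gt0.
Qed.

(** The spectral theorem provides a full list of eigenvalues in [R], so [Esym] takes its genuine
    value and not the dummy one. *)
Lemma Esym_char_poly l S : (l <= m)%N -> S \is symmetricmx ->
  Esym l S = (-1) ^+ l * (char_poly S)`_(m - l).
Proof.
move=> lm /symmetric_spectral[U [d [UU SE]]].
pose lambda := [tuple d 0 i | i < m].
have Sl : eigenvalue_list S lambda.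
  have uU := orthogonal_unitmx UU.
  have UV : U^T = invmx U by rewrite -[LHS](mulKmx uU) UU mulmx1.
  rewrite /eigenvalue_list SE UV char_poly_similar // char_poly_trig ?diag_mx_is_trig //.
  by rewrite big_tuple; apply: eq_bigr => i _; rewrite tnth_mktuple !mxE eqxx mulr1n.
by rewrite (EsymE l Sl) (elem_sym_char_poly lm Sl).
Qed.

Lemma Esym_congr_diag l X d : (l <= m)%N -> X \in unitmx ->
  Esym l (X *m diag_mx d *m X^T) =
  \sum_(I : {set 'I_m} | #|I| == l) (\prod_(i in I) d 0 i) * \det (row_mask I (X^T *m X)).
Proof.
move=> lm uX; rewrite Esym_char_poly //; last first.
  by apply/symmetricmxP; rewrite !trmx_mul trmxK tr_diag_mx mulmxA.
have -> : X *m diag_mx d *m X^T = X *m (diag_mx d *m (X^T *m X)) *m invmx X.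
  by rewrite !mulmxA mulmxK.
rewrite char_poly_similar // coef_char_poly // mulrA -exprMn mulrNN mulr1 expr1n mul1r.
by apply: eq_bigr => I _; rewrite det_row_mask_mul.
Qed.

Lemma Esym_gram l X : (l <= m)%N -> X \in unitmx ->
  Esym l (X *m X^T) = \sum_(I : {set 'I_m} | #|I| == l) \det (row_mask I (X^T *m X)).
Proof.
move=> lm uX; rewrite -{1}[X]mulmx1 -diag_const_mx Esym_congr_diag //.
by apply: eq_bigr => I _; rewrite big1 ?mul1r // => i _; rewrite mxE.
Qed.

Lemma det_row_mask_gram_gt0 I X : X \in unitmx -> 0 < \det (row_mask I (X^T *m X)).
Proof.
move=> uX; apply: det_row_mask_gt0.
have -> : X^T *m X = X^T *m 1%:M *m X^T^T by rewrite mulmx1 trmxK.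
apply: posdefmx_congr; rewrite ?unitmx_tr //; split=> [|x x0].
  by apply/symmetricmxP; rewrite trmx1.
by rewrite mulmx1 sqnorm_gt0.
Qed.

Lemma prod_powR d t I : (forall i, 0 < d 0 i) ->
  (* Multiplicativity of the power is used for nonnegative bases, so the induction below carries
     positivity of the partial products along with the identity. *)
  \prod_(i in I) powR_row t d 0 i = (\prod_(i in I) d 0 i) `^ t.
Proof.
move=> d0; pose K a b : Prop := 0 < a /\ b = a `^ t.
suff [] : K (\prod_(i in I) d 0 i) (\prod_(i in I) powR_row t d 0 i) by [].
apply: big_ind2 => [|a b a' b' [a0 ->] [a'0 ->]|i _]; split => //.
- by rewrite powR1.
- by rewrite mulr_gt0.
- by rewrite powRM ?ltW.
- by rewrite mxE.
Qed.

(** Take C = P^(1/2), B = P^(-1/2) and diagonalize B Q B = V diag(d) V^T. Then X = C V works: the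
    orthogonal [V] cancels in X X^T = C C = P, and the definition of the geodesic reads C V
    diag(d^t) V^T C. Neither [X] nor [d] depends on [t]. *)
Lemma geomean_simultaneous P Q : posdefmx P -> posdefmx Q ->
  exists X d, [/\ X \in unitmx, forall i, 0 < d 0 i, P = X *m X^T,
    Q = X *m diag_mx d *m X^T &
    forall t, geomean t P Q = X *m diag_mx (powR_row t d) *m X^T].
Proof.
move=> Ppos Qpos; have [U [e PUe]] := symmetric_spectral Ppos.1.
have e0 i := posdefmx_spectral_gt0 i Ppos PUe; have [UU PE] := PUe.
have U'U : U^T *m U = 1%:M by apply: mulmx1C.
pose A s := U *m diag_mx (powR_row s e) *m U^T.
have AT s : (A s)^T = A s by rewrite !trmx_mul trmxK tr_diag_mx mulmxA.
(* The powers of [P] form a one-parameter group; adding exponents, possibly to 0, is licensed by the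
   eigenvalues being nonzero. *)
have AM s r : A s *m A r = A (s + r).
  rewrite /A !mulmxA -(mulmxA _ U^T) U'U mulmx1 -(mulmxA U); congr (_ *m _ *m _).
  apply/matrixP => i j; rewrite mul_diag_mx !mxE mulrnAr powRD //.
  by rewrite (gt_eqF (e0 i)) implybT.
have A0 : A 0 = 1%:M.
  rewrite /A (_ : powR_row 0 e = const_mx 1) ?diag_const_mx ?mulmx1 //.
  by apply/rowP => i; rewrite !mxE powRr0.
have A1 : A 1 = P.
  rewrite PE /A; congr (_ *m diag_mx _ *m _); apply/rowP => i.
  by rewrite mxE powRr1 // ltW.
have [B BE] : exists B, B = A (- (1 / 2)) by exists (A (- (1 / 2))).
have [C CE] : exists C, C = A (1 / 2) by exists (A (1 / 2)).
have CB : C *m B = 1%:M by rewrite CE BE AM subrr.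
have BC : B *m C = 1%:M by rewrite CE BE AM addNr.
have CC : C *m C = P by rewrite CE AM -A1; congr A; field.
have [BT CT] : B^T = B /\ C^T = C by rewrite BE CE !AT.
have [uC uB] := mulmx1_unit CB.
have Qpos' : posdefmx (B *m Q *m B) by rewrite -[X in _ *m X]BT; exact: posdefmx_congr.
have [V [d QVd]] := symmetric_spectral Qpos'.1; have [VV QE] := QVd.
exists (C *m V), d; split.
- by rewrite unitmx_mul uC orthogonal_unitmx.
- by move=> i; exact: posdefmx_spectral_gt0 QVd.
- by rewrite trmx_mul mulmxA -(mulmxA C) VV mulmx1 CT CC.
- transitivity (C *m (B *m Q *m B) *m C); last by rewrite QE trmx_mul CT !mulmxA.
  by rewrite !mulmxA CB mul1mx -mulmxA BC mulmx1.
- move=> t; rewrite /geomean !(mxpowRE _ PUe) -/(A _) -/(A _) -BE -CE (mxpowRE t QVd).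
  by rewrite trmx_mul CT !mulmxA.
Qed.

End PositiveDefinite.

(** * Log-convexity of positive sums of exponentials *)

Section LogConvexity.
Variable R : realType.
Implicit Types (t x p q : R).

(** Weighted arithmetic-geometric mean inequality for 1 and [x]; the right-hand side is the tangent
    at 1 of the concave function x^t. *)
Lemma powR_le_affine t x : 0 < x -> 0 <= t <= 1 -> x `^ t <= 1 - t + t * x.
Proof.
move=> x0 /andP[t0 t1]; pose v := ln x.
have xE : x = expR v by rewrite lnK.
have h1 := expR_ge1Dx ((1 - t) * v); have h2 := expR_ge1Dx (- (t * v)).
have E1 : expR (t * v) * expR ((1 - t) * v) = x by rewrite -expRD xE; congr expR; ring.
have E2 : expR (t * v) * expR (- (t * v)) = 1 by rewrite -expRD subrr expR0.
rewrite /powR gt_eqF // -/v.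
(* The bounds 1 + y <= exp y at y = (1 - t)v and y = -tv are averaged with weights t and 1 - t, so
   that the terms in [v] cancel and 1 remains. *)
have : expR (t * v) * 1 <=
    expR (t * v) * (t * expR ((1 - t) * v) + (1 - t) * expR (- (t * v))).
  by rewrite ler_pM2l ?expR_gt0 //; nra.
by rewrite mulr1 mulrDr !(mulrCA (expR (t * v))) E1 E2 mulr1 addrC.
Qed.

(** This is Hölder's inequality for the weights [c], in logarithmic form. Rescaling [w] by p / q
    makes its [c]-weighted mean 1; the affine bound on powers, applied term by term, then sums to
    exactly [p]. *)
Lemma ln_sum_powR_le (J : finType) (D : pred J) (c w : J -> R) t :
  (forall j, D j -> 0 < c j) -> (forall j, D j -> 0 < w j) -> (exists j, D j) ->
  0 <= t <= 1 ->
  ln (\sum_(j | D j) c j * w j `^ t) <=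
  (1 - t) * ln (\sum_(j | D j) c j) + t * ln (\sum_(j | D j) c j * w j).
Proof.
move=> c0 w0 [j0 Dj0] t01.
have sum0 (F : J -> R) : (forall j, D j -> 0 < F j) -> 0 < \sum_(j | D j) F j.
  move=> F0; rewrite (bigD1 j0) //= ltr_pwDl ?F0 // sumr_ge0 // => j /andP[Dj _].
  by rewrite ltW ?F0.
set p := \sum_(j | D j) c j; set q := \sum_(j | D j) c j * w j.
set s := \sum_(j | D j) c j * w j `^ t.
have p0 : 0 < p by exact: sum0.
have q0 : 0 < q by apply: sum0 => j Dj; rewrite mulr_gt0 ?c0 ?w0.
have s0 : 0 < s by apply: sum0 => j Dj; rewrite mulr_gt0 ?powR_gt0 ?c0 ?w0.
have pq0 : 0 < p / q by rewrite divr_gt0.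
have : s * (p / q) `^ t <= p.
  have {2}-> : p = \sum_(j | D j) c j * (1 - t + t * (w j * (p / q))).
    transitivity (\sum_(j | D j) (c j * (1 - t) + c j * w j * (t * (p / q)))).
      rewrite big_split /= -!mulr_suml -/p -/q; field; exact: lt0r_neq0.
    by apply: eq_bigr => j _; ring.
  rewrite big_distrl; apply: ler_sum => j Dj /=.
  rewrite -mulrA ler_pM2l ?c0 // -powRM ?(ltW (w0 _ Dj)) ?(ltW pq0) //.
  by apply: powR_le_affine => //; rewrite mulr_gt0 ?w0.
rewrite -ler_ln ?posrE ?mulr_gt0 ?powR_gt0 // lnM ?posrE ?powR_gt0 // ln_powR ln_div ?posrE //.
by nra.
Qed.

End LogConvexity.

(** * Positivity of [Esym] and its log-convexity along geodesics *)

Theorem lemma3p3 (R : realType) (m l : nat) (hl : (1 <= l)%N) (hlm : (l <= m)%N) :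
  @geodesically_log_convex R m (@Esym R m l).
Proof.
(* The first [l] indices form such a set. The sums over sets of size [l] are therefore nonempty,
   hence positive, and their logarithms are meaningful. *)
have ex_I : exists I : {set 'I_m}, #|I| == l.
  exists [set widen_ord hlm i | i : 'I_l].
  by rewrite card_imset ?card_ord // => i j /(congr1 val) /= /val_inj.
split=> [P Ppos|P Q t Ppos Qpos t01].
  (* Taking Q = P is a way to obtain the factorization P = X X^T with [X] invertible. *)
  have [X [d [uX _ PE _ _]]] := geomean_simultaneous Ppos Ppos.
  rewrite PE (Esym_gram hlm uX); have [I0 I0l] := ex_I.
  rewrite (bigD1 I0) //= ltr_pwDl ?det_row_mask_gram_gt0 //.
  by apply: sumr_ge0 => I _; rewrite ltW ?det_row_mask_gram_gt0.
have [X [d [uX d0 PE QE tE]]] := geomean_simultaneous Ppos Qpos.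
have I_gt0 I : 0 < \det (row_mask I (X^T *m X)) by exact: det_row_mask_gram_gt0.
pose w (I : {set 'I_m}) := \prod_(i in I) d 0 i.
have w0 I : 0 < w I by apply: prodr_gt0.
have EP : Esym l P = \sum_(I : {set 'I_m} | #|I| == l) \det (row_mask I (X^T *m X)).
  by rewrite PE Esym_gram.
have EQ : Esym l Q = \sum_(I : {set 'I_m} | #|I| == l) \det (row_mask I (X^T *m X)) * w I.
  by rewrite QE Esym_congr_diag //; apply: eq_bigr => I _; rewrite mulrC.
have Et : Esym l (geomean t P Q) =
    \sum_(I : {set 'I_m} | #|I| == l) \det (row_mask I (X^T *m X)) * w I `^ t.
  by rewrite tE Esym_congr_diag //; apply: eq_bigr => I _; rewrite prod_powR // mulrC.
by rewrite Et EP EQ; apply: ln_sum_powR_le.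
Qed.
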